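(* Let $M$ be a (local) timelike surface in a three-dimensional Lorentzian manifold $\mathbb{L}^3$ as in the context, and let $\gamma^1,\gamma^2$ be the 1-forms on $M$ defined in the context. Suppose that $M$ has non-constant mean curvature $H$ or has non-zero normal curvature. Then exterior differentiation of the total differential equation $$dT=T\gamma^1+\gamma^2 \qquad (\text{unknown function } T \text{ on } M)$$ gives $$T\,d\gamma^1+(d\gamma^2-\gamma^1\wedge\gamma^2)=0 .$$ Consequently, the equation $dT=T\gamma^1+\gamma^2$ is completely integrable if and only if $$d\gamma^1=0\quad\text{and}\quad d\gamma^2=\gamma^1\wedge\gamma^2 .$$
   Context: Setting. $(\mathbb{L}^3,g)$ is a three-dimensional Lorentzian manifold with curvature tensor $R$, and $M$ is a local timelike surface in it, given by an embedding $x:M\to\mathbb{L}^3$. It is assumed throughout that $M$ has no umbilic points and that its shape operator $A$ is diagonalizable. $(e_1,e_2)$ is an orthonormal frame on $M$ of eigenvectors of $A$, with $e_1$ timelike and $e_2$ spacelike, $A e_1=a e_1$, $A e_2=c e_2$; $e_3=e_1\times e_2$ is the unit normal (vector product of $\mathbb{L}^3$). $(\omega^1,\omega^2)$ is the coframe on $M$ dual to $(e_1,e_2)$, and the first fundamental form is written $I=(\omega^1)^2-(\omega^2)^2$. The functions $a\neq c$ are the principal curvatures, $H=\frac{a+c}{2}$ is the mean curvature, and $J=\frac{a-c}{2}>0$. Normal curvature. For $i=1,2$ let $\psi_i^3(X,Y)=g(R(X,Y)e_i,e_3)$ for $X,Y\in TM$. The functions $\lambda_1^3,\lambda_2^3$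 on $M$ are defined by $$\psi_1^3=(c-a)\lambda_1^3\,\omega^2\wedge\omega^1,\qquad \psi_2^3=(c-a)\lambda_2^3\,\omega^1\wedge\omega^2 .$$ ''$M$ has zero normal curvature'' means $\lambda_1^3=\lambda_2^3=0$ on $M$; ''non-zero normal curvature'' is the negation. The 1-forms. The functions $u,v$ on $M$ are determined by $2\,dH=(a-c)(u\,\omega^1+v\,\omega^2)$. Put $$\alpha^1=u\,\omega^1-v\,\omega^2,\qquad \alpha^2=-v\,\omega^1+u\,\omega^2,$$ $$\beta=\lambda_1^3\,\omega^1+\lambda_2^3\,\omega^2,\qquad \star\beta=\lambda_2^3\,\omega^1+\lambda_1^3\,\omega^2,$$ where $\star$ is the Hodge operator with $\star\omega^1=\omega^2$, $\star\omega^2=\omega^1$. Define $$\gamma^1=\alpha^1-2\star\beta,\qquad \gamma^2=\alpha^2-2\beta .$$ Complete integrability of $dT=T\gamma^1+\gamma^2$ is meant in the Frobenius sense: for every point $p\in M$ and every real value $T_0$ there is a solution $T$ in a neighbourhood of $p$ with $T(p)=T_0$. (In the paper $T=\coth\varphi$, where $\varphi$ is the hyperbolic angle between the principal coframes of $M$ and of an isometric deformation of $M$ preserving the principal curvatures.) *)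

(* Defs.v *)
From HB Require Import structures.
From mathcomp Require Export all_boot all_order all_algebra.
From mathcomp Require Export all_classical all_reals all_analysis.

Set Implicit Arguments.
Unset Strict Implicit.
Unset Printing Implicit Defensive.

Import Order.TTheory GRing.Theory Num.Theory.
Export numFieldNormedType.Exports.

Local Open Scope classical_set_scope.
Local Open Scope ring_scope.

Section Smooth.
Variables (R : realType) (n : nat) (W : normedModType R).

(* To be used with [U] open. *)
Fixpoint Ck (k : nat) (U : set 'rV[R]_n) (f : 'rV[R]_n -> W) : Prop :=
  match k with
  | 0 => forall p, U p -> {for p, continuous f}
  | k'.+1 => (forall p, U p -> differentiable f p) /\
             (forall i, Ck k' U (fun p => 'D_(delta_mx 0 i) f p))
  end.

Definition smooth (U : set 'rV[R]_n) (f : 'rV[R]_n -> W) : Prop :=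
  forall k, Ck k U f.

End Smooth.

(* The orientation is what makes the vector product of a Lorentzian 3-manifold
   well defined.  [param i] is the inverse of [chart i]; its values off the
   image of [chart i] are irrelevant. *)
Record oriented_manifold (R : realType) (n : nat) := OrientedManifold {
  point :> topologicalType;
  manifold_hausdorff : hausdorff_space point;
  manifold_countable : @second_countable point;
  index : Type;
  dom : index -> set point;
  chart : index -> point -> 'rV[R]_n;
  param : index -> 'rV[R]_n -> point;
  dom_cover : forall q, exists i, dom i q;
  dom_open : forall i, open (dom i);
  chartK : forall i q, dom i q -> param i (chart i q) = q;
  chart_continuous : forall i q, dom i q -> {for q, continuous (chart i)};
  chart_open : forall i (U : set point),
    open U -> U `<=` dom i -> open (chart i @` U);
  transition_smooth : forall i j,
    smooth (chart i @` (dom i `&` dom j)) (chart j \o param i);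
  transition_oriented : forall i j q, dom i q -> dom j q ->
    0 < \det ('J (chart j \o param i) (chart i q)) }.

Arguments index {R n} o.
Arguments dom {R n} o i.
Arguments chart {R n} o i.
Arguments param {R n} o i.

(* Signature (+,-,-), so that the first fundamental form of a timelike surface
   is [(omega^1)^2 - (omega^2)^2] with [e_1] timelike. *)
Definition minkowski (R : realType) : 'M[R]_3 :=
  diag_mx (\row_j (if j == 0 then 1 else -1)).

(* [metric i] is the Gram matrix of the metric in [chart i], as a function of
   the coordinates.  Tangent vectors are row vectors, so that the differential
   of a map [f] is [v |-> v *m 'J f p]. *)
Record lorentzian_metric (R : realType) (L : oriented_manifold R 3) :=
  LorentzianMetric {
  metric :> index L -> 'rV[R]_3 -> 'M[R]_3;
  metric_smooth : forall i, smooth (chart L i @` dom L i) (metric i);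
  metric_sym : forall i q, dom L i q ->
    (metric i (chart L i q))^T = metric i (chart L i q);
  metric_signature : forall i q, dom L i q ->
    exists2 P : 'M[R]_3, P \in unitmx &
      P *m metric i (chart L i q) *m P^T = minkowski R;
  metric_change : forall i j q, dom L i q -> dom L j q ->
    let J := 'J (chart L j \o param L i) (chart L i q) in
    metric i (chart L i q) = J *m metric j (chart L j q) *m J^T }.

(* Tensor calculus of a metric [g] in one coordinate chart. *)
Section Chart.
Variable R : realType.
Implicit Types (G : 'M[R]_3) (g : 'rV[R]_3 -> 'M[R]_3) (q X Y Z : 'rV[R]_3).

Definition inner G X Y : R := (X *m G *m Y^T) 0 0.

(* The vector [V] such that [inner G V Z = sqrt |det G| * det (X, Y, Z)] for
   all [Z], i.e. the vector product given by the metric volume form. *)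
Definition cross G X Y : 'rV[R]_3 :=
  (\row_l (Num.sqrt `|\det G| *
     \det (col_mx X (col_mx Y (delta_mx 0 l)) : 'M[R]_3))) *m invmx G.

Definition christoffel g (k i j : 'I_3) q : R :=
  2^-1 * \sum_l invmx (g q) k l *
    ('D_(delta_mx 0 i) (fun r => g r j l) q
     + 'D_(delta_mx 0 j) (fun r => g r i l) q
     - 'D_(delta_mx 0 l) (fun r => g r i j) q).

(* [riemann g l k i j] is the [l]-th component of [R(d_i, d_j) d_k], for
   [R(X, Y) = [nabla_X, nabla_Y] - nabla_[X, Y]]. *)
Definition riemann g (l k i j : 'I_3) q : R :=
  'D_(delta_mx 0 i) (christoffel g l j k) q
  - 'D_(delta_mx 0 j) (christoffel g l i k) q
  + \sum_m (christoffel g l i m q * christoffel g m j k q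
            - christoffel g l j m q * christoffel g m i k q).

Definition curvature g q X Y Z : 'rV[R]_3 :=
  \row_l \sum_i \sum_j \sum_k riemann g l k i j q * X 0 i * Y 0 j * Z 0 k.

(* Below, [y] is the expression of a parametrized surface in the chart. *)
Implicit Types (e : 'rV[R]_2 -> 'rV[R]_2) (y N : 'rV[R]_2 -> 'rV[R]_3).
Implicit Types (p V : 'rV[R]_2).

Definition push y e p : 'rV[R]_3 := 'D_(e p) y p.

(* Levi-Civita derivative along [y] of the vector field [N], in the
   direction [V]. *)
Definition covariant g y N V p : 'rV[R]_3 :=
  'D_V N p + \row_k \sum_i \sum_j
    christoffel g k i j (y p) * ('D_V y p) 0 i * N p 0 j.

Definition unit_normal g y e1 e2 p : 'rV[R]_3 :=
  cross (g (y p)) (push y e1 p) (push y e2 p).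

(* The image in the ambient space of [A V]. *)
Definition shape g y e1 e2 V p : 'rV[R]_3 :=
  - covariant g y (unit_normal g y e1 e2) V p.

End Chart.

(* Differential forms on open subsets of the plane: a 1-form is given by its
   column of coefficients, a 2-form by its values on pairs of vectors. *)
Section Forms.
Variable R : realType.

Definition form1 := 'rV[R]_2 -> 'cV[R]_2.
Definition form2 := 'rV[R]_2 -> 'rV[R]_2 -> 'rV[R]_2 -> R.

Definition ev (th : form1) (p X : 'rV[R]_2) : R := (X *m th p) 0 0.

Definition wedge (th et : form1) : form2 :=
  fun p X Y => ev th p X * ev et p Y - ev th p Y * ev et p X.

(* [dth(X, Y) = X (th(Y)) - Y (th(X)) - th([X, Y])], here with [X] and [Y]
   constant vector fields. *)
Definition extd (th : form1) : form2 :=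
  fun p X Y => 'D_X (fun q => ev th q Y) p - 'D_Y (fun q => ev th q X) p.

Definition dual_coframe (D : set 'rV[R]_2) (e1 e2 : 'rV[R]_2 -> 'rV[R]_2)
    (om1 om2 : form1) : Prop :=
  forall p, D p -> [/\ ev om1 p (e1 p) = 1, ev om1 p (e2 p) = 0,
                       ev om2 p (e1 p) = 0 & ev om2 p (e2 p) = 1].

Definition lincomb (f1 f2 : 'rV[R]_2 -> R) (om1 om2 : form1) : form1 :=
  fun p => f1 p *: om1 p + f2 p *: om2 p.

Definition solution (U : set 'rV[R]_2) (gm1 gm2 : form1)
    (T : 'rV[R]_2 -> R) : Prop :=
  forall p, U p -> differentiable T p /\
    forall X, 'D_X T p = T p * ev gm1 p X + ev gm2 p X.

Definition completely_integrable (D : set 'rV[R]_2) (gm1 gm2 : form1) : Prop :=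
  forall p (T0 : R), D p -> exists (U : set 'rV[R]_2) (T : 'rV[R]_2 -> R),
    [/\ open U, U p, U `<=` D, solution U gm1 gm2 T & T p = T0].

End Forms.

(* A local surface is an open subset [D] of the parameter plane embedded in [L]
   by [x]; tangent vectors to it are vectors of the parameter plane.  Conditions
   involving the ambient geometry are required in every chart of [L] around the
   point; by covariance one chart suffices. *)
Section Surface.
Variables (R : realType) (L : oriented_manifold R 3).
Implicit Types (D : set 'rV[R]_2) (x : 'rV[R]_2 -> L).
Implicit Types (g : lorentzian_metric L) (e : 'rV[R]_2 -> 'rV[R]_2).

Definition local_expr x (i : index L) : 'rV[R]_2 -> 'rV[R]_3 := chart L i \o x.

Definition embedding D x : Prop :=
  [/\ forall p, D p -> {for p, continuous x},
      forall i, smooth (D `&` x @^-1` dom L i) (local_expr x i),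
      forall i p V, D p -> dom L i (x p) ->
        'D_V (local_expr x i) p = 0 -> V = 0,
      forall p q, D p -> D q -> x p = x q -> p = q &
      forall U : set 'rV[R]_2, open U -> U `<=` D ->
        exists2 O : set L, open O & x @` U = O `&` x @` D].

(* [e1] timelike and [e2] spacelike; in particular the surface is timelike. *)
Definition orthonormal_frame g D x e1 e2 : Prop :=
  forall i p, D p -> dom L i (x p) ->
    let y := local_expr x i in
    let G := g i (y p) in
    [/\ inner G (push y e1 p) (push y e1 p) = 1,
        inner G (push y e1 p) (push y e2 p) = 0 &
        inner G (push y e2 p) (push y e2 p) = -1].

Definition principal_frame g D x e1 e2 (a c : 'rV[R]_2 -> R) : Prop :=
  forall i p, D p -> dom L i (x p) ->
    let y := local_expr x i in
    shape (g i) y e1 e2 (e1 p) p = a p *: push y e1 p /\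
    shape (g i) y e1 e2 (e2 p) p = c p *: push y e2 p.

(* [psi_j^3 (X, Y) = g (R(X, Y) e_j, e_3)], for [e := e_j]. *)
Definition psi3 g x e1 e2 (i : index L) e : form2 R :=
  fun p X Y =>
    let y := local_expr x i in
    inner (g i (y p))
      (curvature (g i) (y p) ('D_X y p) ('D_Y y p) (push y e p))
      (unit_normal (g i) y e1 e2 p).

Definition normal_curvature g D x e1 e2 (om1 om2 : form1 R)
    (a c la1 la2 : 'rV[R]_2 -> R) : Prop :=
  forall i p X Y, D p -> dom L i (x p) ->
    psi3 g x e1 e2 i e1 p X Y = (c p - a p) * la1 p * wedge om2 om1 p X Y /\
    psi3 g x e1 e2 i e2 p X Y = (c p - a p) * la2 p * wedge om1 om2 p X Y.

End Surface.

Section Gamma.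
Variable R : realType.
Implicit Types (om : form1 R) (a c u v la : 'rV[R]_2 -> R).

Definition mean_curvature a c (p : 'rV[R]_2) : R := (a p + c p) / 2.

(* [2 dH = (a - c) (u omega^1 + v omega^2)] *)
Definition mean_curvature_differential D om1 om2 a c u v : Prop :=
  forall p X, D p -> 2 * 'D_X (mean_curvature a c) p
                     = (a p - c p) * ev (lincomb u v om1 om2) p X.

Definition alpha1 om1 om2 u v : form1 R := lincomb u (fun p => - v p) om1 om2.
Definition alpha2 om1 om2 u v : form1 R := lincomb (fun p => - v p) u om1 om2.
Definition beta om1 om2 la1 la2 : form1 R := lincomb la1 la2 om1 om2.
Definition star_beta om1 om2 la1 la2 : form1 R := lincomb la2 la1 om1 om2.

Definition gamma1 om1 om2 u v la1 la2 : form1 R :=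
  fun p => alpha1 om1 om2 u v p - 2 *: star_beta om1 om2 la1 la2 p.
Definition gamma2 om1 om2 u v la1 la2 : form1 R :=
  fun p => alpha2 om1 om2 u v p - 2 *: beta om1 om2 la1 la2 p.

End Gamma.

(* Main.v *)
From HB Require Import structures.
Require Import Defs.
From mathcomp Require Import ring lra.

(** The equation [dT = T gm1 + gm2] is affine in the unknown.  If [T] solves it,
    then [d (dT) = 0] reads
    [0 = dT /\ gm1 + T d gm1 + d gm2 = T d gm1 + (d gm2 - gm1 /\ gm2)],
    because [gm1 /\ gm1 = 0].  When solutions with arbitrary value at each point
    exist, this identity holds with [T] replaced by 0 and by 1, which gives the
    two integrability conditions.  Conversely, if [d gm1 = 0], then [gm1 = df]
    locally, the second condition says that [exp (- f) gm2] is closed, hence is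
    some [dh], and [T = exp f (h + C)] solves the equation.

    Three ingredients make this argument rigorous.
    - The forms [gm1] and [gm2] are smooth ([smooth_gamma]).  This is implicit
      in the geometry: the coefficients [a], [c], [u], [v], [la1], [la2] are
      bare functions, pinned down by equations whose other terms are built from
      the metric, the embedding and the frame by differentiation and by
      algebraic operations.  Smoothness passes through these operations
      (inverse matrices since the metric is nondegenerate, the square root in
      the volume form since [det g > 0]), and [a - c > 0] allows solving for
      the coefficients.
    - [d (dT) = 0] is the symmetry of mixed derivatives ([mixed_derivatives])
      under the hypothesis that the first derivatives are differentiable.
    - Closed smooth 1-forms on a ball have a potential ([poincare]), obtained by
      integration along rays and differentiation under the integral sign; a
      potential is differentiable because its directional derivatives depend
      continuously on the point ([differentiable_of_directional]). *)

Set Implicit Arguments.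
Unset Strict Implicit.
Unset Printing Implicit Defensive.
Import Order.TTheory GRing.Theory Num.Theory.
Local Open Scope classical_set_scope.
Local Open Scope ring_scope.

(** * Closure properties of smooth functions *)

Section FrechetEps.
Variables (R : realType) (V W : normedModType R).
Implicit Types (f : V -> W) (p : V).

(** The defining estimate of the Fréchet derivative in epsilon form, which
    unlike the Landau form can be combined with pointwise bounds. *)
Lemma differentiable_eps f (l : {linear V -> W}) p : continuous l ->
  (forall e, 0 < e ->
     \forall h \near 0, `|f (h + p) - f p - l h| <= e * `|h|) ->
  differentiable f p.
Proof.
move=> cl fl.
have L : f \o shift p = cst (f p) + l +o_ (0 : V) id.
  apply/eqaddoP => e e0; apply: filterS (fl e e0) => h /=.
  by rewrite !fctE /= opprD addrA.
by apply/diff_locallyP; rewrite (diff_unique cl L).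
Qed.

Lemma differentiable_le f p e : differentiable f p -> 0 < e ->
  \forall h \near 0, `|f (h + p) - f p - 'd f p h| <= e * `|h|.
Proof.
move=> /diff_locally/eqaddoP df e0; apply: filterS (df e e0) => h /=.
by rewrite !fctE /= opprD addrA.
Qed.

Lemma derive_chain (Z : normedModType R) (f : V -> W) (h : W -> Z) p v :
  differentiable f p -> differentiable h (f p) ->
  'D_v (h \o f) p = 'D_('D_v f p) h (f p).
Proof.
move=> df dh; have dhf := differentiable_comp df dh.
by rewrite (deriveE v dhf) diff_comp //= (deriveE _ dh) (deriveE _ df).
Qed.

End FrechetEps.

Section CkTheory.
Variables (R : realType) (n : nat).
Implicit Types U V : set 'rV[R]_n.

Section Valued.
Variable W : normedModType R.
Implicit Types f g : 'rV[R]_n -> W.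

Lemma Ck_local k U f :
  (forall p, U p -> exists2 V, V p & Ck k V f) -> Ck k U f.
Proof.
elim: k f => [|k IH] f /= Uf.
  by move=> p Up; have [V Vp] := Uf p Up; apply.
split=> [p Up|i]; first by have [V Vp [+ _]] := Uf p Up; apply.
by apply: IH => p Up; have [V Vp [_ Vf]] := Uf p Up; exists V.
Qed.

Lemma Ck_subset k U V f : V `<=` U -> Ck k U f -> Ck k V f.
Proof. by move=> VU Uf; apply: Ck_local => p /VU Up; exists U. Qed.

Lemma Ck_pred k U f : Ck k.+1 U f -> Ck k U f.
Proof.
elim: k f => [|k IH] f /= [df Df].
  by move=> p /df; apply: differentiable_continuous.
by split=> // i; apply: IH; apply: Df.
Qed.

Lemma near_open_eq U f g : open U -> (forall p, U p -> f p = g p) ->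
  forall p, U p -> \forall q \near p, f q = g q.
Proof.
move=> oU fg p Up; apply: (filterS _ (open_nbhs_nbhs (conj oU Up))).
exact: fg.
Qed.

(** Differentiability at a point depends only on the germ.  This is what lets
    the [k]-fold smoothness of a function be transported along an equality that
    holds on an open set only, as every formula below for a derivative does. *)
Lemma near_eq_differentiable f g p :
  (\forall q \near p, f q = g q) -> differentiable f p -> differentiable g p.
Proof.
move=> fg df; apply: (differentiable_eps (l := 'd f p)) => [|e e0].
  exact: diff_continuous.
have fg0 : \forall h \near (0 : 'rV[R]_n), f (h + p) = g (h + p).
  by move: fg; rewrite (near_shift 0) subr0.
apply: filterS2 fg0 (differentiable_le df e0) => h <-.
by rewrite (nbhs_singleton fg).
Qed.

Lemma Ck_eq k U f g : open U -> (forall p, U p -> f p = g p) ->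
  Ck k U f -> Ck k U g.
Proof.
move=> oU; elim: k f g => [|k IH] f g fg.
  move=> Uf p Up; have fp : f @ p --> f p := Uf p Up.
  rewrite (fg p Up) in fp.
  exact: cvg_trans (near_eq_cvg (near_open_eq oU fg Up)) fp.
move=> /= [df Df]; split=> [p Up|i].
  by apply: near_eq_differentiable (df p Up); apply: near_open_eq oU _ _ Up.
apply: IH (Df i) => p Up.
by apply: near_eq_derive; apply: near_open_eq oU _ _ Up.
Qed.

Lemma smooth_eq U f g : open U -> (forall p, U p -> f p = g p) ->
  smooth U f -> smooth U g.
Proof. by move=> oU fg Uf k; apply: Ck_eq (Uf k). Qed.

Lemma smooth_subset U V f : V `<=` U -> smooth U f -> smooth V f.
Proof. by move=> VU Uf k; apply: Ck_subset (Uf k). Qed.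

Lemma smooth_differentiable U f p : smooth U f -> U p -> differentiable f p.
Proof. by move=> /(_ 1%N) [+ _]; apply. Qed.

Lemma smooth_derivable U f p X : smooth U f -> U p -> derivable f p X.
Proof.
by move=> Uf Up; apply: diff_derivable; apply: smooth_differentiable Up.
Qed.

Lemma smooth_partial U f i : smooth U f ->
  smooth U (fun p => 'D_(delta_mx 0 i) f p).
Proof. by move=> Uf k; have [_] := Uf k.+1; apply. Qed.

Lemma smooth_of_partials U f : (forall p, U p -> differentiable f p) ->
  (forall i, smooth U (fun p => 'D_(delta_mx 0 i) f p)) -> smooth U f.
Proof.
move=> df Df k; apply: Ck_pred; split=> // i; exact: Df.
Qed.

Lemma Ck_cst k U (w : W) : Ck k U (fun=> w).
Proof.
elim: k w => [|k IH] w /=; first by move=> p _; exact: cst_continuous.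
split=> [p _|i]; first exact: differentiable_cst.
suff -> : (fun p : 'rV[R]_n => 'D_(delta_mx 0 i) (fun=> w) p) = fun=> 0.
  exact: IH.
by apply/funext => p; apply: derive_cst.
Qed.

Lemma Ck_add k U f g : open U -> Ck k U f -> Ck k U g ->
  Ck k U (fun p => f p + g p).
Proof.
move=> oU; elim: k f g => [|k IH] f g.
  by move=> cf cg p Up; apply: continuousD; [exact: cf|exact: cg].
move=> /= [df Df] [dg Dg]; split=> [p Up|i].
  by apply: differentiableD; [apply: df|apply: dg].
apply: Ck_eq (IH _ _ (Df i) (Dg i)) => // p Up; apply/esym/deriveD.
  exact/diff_derivable/df.
exact/diff_derivable/dg.
Qed.

End Valued.

Section Scalar.
Implicit Types f g : 'rV[R]_n -> R.

Lemma Ck_mul k U f g : open U -> Ck k U f -> Ck k U g ->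
  Ck k U (fun p => f p * g p).
Proof.
move=> oU; elim: k f g => [|k IH] f g.
  by move=> cf cg p Up; apply: continuousM; [exact: cf|exact: cg].
move=> Cf Cg; move: (Cf) (Cg) => /= [df Df] [dg Dg]; split=> [p Up|i].
  by apply: differentiableM; [apply: df|apply: dg].
have C1 := IH _ _ (Ck_pred Cf) (Dg i); have C2 := IH _ _ (Ck_pred Cg) (Df i).
apply: Ck_eq (Ck_add oU C1 C2) => // p Up; apply/esym/deriveM.
  exact/diff_derivable/df.
exact/diff_derivable/dg.
Qed.

Lemma smooth_cst U (w : R) : smooth U (fun=> w).
Proof. by move=> k; apply: Ck_cst. Qed.

Lemma smooth_add U f g : open U -> smooth U f -> smooth U g ->
  smooth U (fun p => f p + g p).
Proof. by move=> oU Uf Ug k; apply: Ck_add. Qed.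

Lemma smooth_mul U f g : open U -> smooth U f -> smooth U g ->
  smooth U (fun p => f p * g p).
Proof. by move=> oU Uf Ug k; apply: Ck_mul. Qed.

Lemma smooth_opp U f : open U -> smooth U f -> smooth U (fun p => - f p).
Proof.
move=> oU Uf; apply: (smooth_eq oU (f := fun p => -1 * f p)) => [p _|].
  by rewrite mulN1r.
by apply: smooth_mul => //; apply: smooth_cst.
Qed.

Lemma smooth_sub U f g : open U -> smooth U f -> smooth U g ->
  smooth U (fun p => f p - g p).
Proof. by move=> oU Uf Ug; apply: smooth_add => //; apply: smooth_opp. Qed.

Lemma smooth_sum U (I : Type) (r : seq I) (P : pred I)
    (f : I -> 'rV[R]_n -> R) : open U ->
  (forall i, P i -> smooth U (f i)) ->
  smooth U (fun p => \sum_(i <- r | P i) f i p).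
Proof.
move=> oU Uf; elim: r => [|i r IH].
  by under eq_fun do rewrite big_nil; apply: smooth_cst.
under eq_fun do rewrite big_cons.
by case Pi: (P i) => //; apply: smooth_add => //; apply: Uf.
Qed.

Lemma smooth_prod U (I : Type) (r : seq I) (P : pred I)
    (f : I -> 'rV[R]_n -> R) : open U ->
  (forall i, P i -> smooth U (f i)) ->
  smooth U (fun p => \prod_(i <- r | P i) f i p).
Proof.
move=> oU Uf; elim: r => [|i r IH].
  by under eq_fun do rewrite big_nil; apply: smooth_cst.
under eq_fun do rewrite big_cons.
by case Pi: (P i) => //; apply: smooth_mul => //; apply: Uf.
Qed.

(** [d (1 / f) = - (1 / f)^2 df], so that the order of smoothness of [1 / f]
    increases by induction. *)
Lemma smooth_inv U f : open U -> (forall p, U p -> f p != 0) -> smooth U f ->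
  smooth U (fun p => (f p)^-1).
Proof.
move=> oU f0 Uf; elim=> [|k IH].
  by move=> p Up; apply: continuousV; [exact: f0|exact: (Uf 0%N)].
split=> [p Up|i].
  by apply: differentiableV; [apply: smooth_differentiable Up|apply: f0].
apply: (Ck_eq oU (f := fun p =>
   -1 * ((f p)^-1 * (f p)^-1) * 'D_(delta_mx 0 i) f p)) => [p Up|].
  rewrite [RHS](deriveV (f0 p Up) (smooth_derivable Uf Up)).
  by rewrite mulN1r -expr2 exprVn.
apply: Ck_mul => //; last exact: smooth_partial.
by apply: Ck_mul => //; [apply: Ck_cst|apply: Ck_mul].
Qed.

Lemma smooth_div U f g : open U -> (forall p, U p -> g p != 0) ->
  smooth U f -> smooth U g -> smooth U (fun p => f p / g p).
Proof. by move=> oU g0 Uf Ug; apply: smooth_mul => //; apply: smooth_inv. Qed.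

(** Each derivative is the function itself times a smooth function, so that the
    order of smoothness increases by induction.  This covers the exponential
    and the square root, whose derivatives involve them again. *)
Lemma smooth_log_derivative U f (w : 'I_n -> 'rV[R]_n -> R) : open U ->
  (forall p, U p -> differentiable f p) -> (forall i, smooth U (w i)) ->
  (forall i p, U p -> 'D_(delta_mx 0 i) f p = f p * w i p) -> smooth U f.
Proof.
move=> oU df Uw Df; elim=> [|k IH].
  by move=> p Up; apply/differentiable_continuous/df.
split=> // i; apply: (Ck_eq oU (f := fun p => f p * w i p)) => [p Up|].
  by rewrite Df.
by apply: Ck_mul => //; apply: Uw.
Qed.

End Scalar.

Lemma derive_comp_real (phi : R -> R) (f : 'rV[R]_n -> R) p v d :
  is_derive (f p) 1 phi d -> differentiable f p ->
  differentiable (phi \o f) p /\ 'D_v (phi \o f) p = 'D_v f p * d.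
Proof.
move=> [/derivable1_diffP dphi phid] df; split; first exact: differentiable_comp.
rewrite deriveE; last exact: differentiable_comp.
rewrite diff_comp //= -phid !deriveE // -[X in 'd phi _ X]mulr1.
by rewrite [LHS]linearZ.
Qed.

Lemma smooth_expR U (f : 'rV[R]_n -> R) : open U -> smooth U f ->
  smooth U (fun p => expR (f p)).
Proof.
move=> oU Uf; pose w i p := 'D_(delta_mx 0 i) f p.
have dexp p v : U p -> differentiable (expR \o f) p /\
    'D_v (expR \o f) p = 'D_v f p * expR (f p).
  move=> Up; apply: derive_comp_real (smooth_differentiable Uf Up).
apply: (@smooth_log_derivative _ _ w) => // [p Up|i|i p Up].
- by have [] := dexp p 0 Up.
- exact: smooth_partial.
- by have [_] := dexp p (delta_mx 0 i) Up; rewrite mulrC.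
Qed.

Lemma smooth_sqrt U (f : 'rV[R]_n -> R) : open U ->
  (forall p, U p -> 0 < f p) -> smooth U f ->
  smooth U (fun p => Num.sqrt (f p)).
Proof.
move=> oU f0 Uf; pose w i p := 'D_(delta_mx 0 i) f p * (2 * f p)^-1.
have dsqrt p v : U p -> differentiable (Num.sqrt \o f) p /\
    'D_v (Num.sqrt \o f) p = 'D_v f p * (2 * Num.sqrt (f p))^-1.
  move=> Up; apply: derive_comp_real (smooth_differentiable Uf Up).
  exact/is_derive1_sqrt/f0.
apply: (@smooth_log_derivative _ _ w) => // [p Up|i|i p Up].
- by have [] := dsqrt p 0 Up.
- apply: smooth_mul; [by []|exact: smooth_partial|].
  apply: smooth_inv => // [p /f0 fp|]; first by rewrite mulf_neq0 ?gt_eqF.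
  by apply: smooth_mul => //; apply: smooth_cst.
- have [_ ->] := dsqrt p (delta_mx 0 i) Up.
  have s0 : Num.sqrt (f p) != 0 by rewrite gt_eqF // sqrtr_gt0 f0.
  have fE : f p = Num.sqrt (f p) ^+ 2 by rewrite sqr_sqrtr // ltW // f0.
  rewrite /w; set s := Num.sqrt (f p) in s0 fE *.
  by rewrite fE; field.
Qed.

Section Entries.
Variables (a b : nat) (M : 'rV[R]_n -> 'M[R]_(a, b)).

Lemma differentiable_entry p i j : differentiable M p ->
  differentiable (fun q => M q i j) p.
Proof.
move=> dM; apply: (differentiable_comp (g := fun A : 'M[R]_(a, b) => A i j)) dM _.
exact: differentiable_coord.
Qed.

Lemma derive_entry p v i j : derivable M p v ->
  ('D_v M p) i j = 'D_v (fun q => M q i j) p.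
Proof. by move=> dM; rewrite derive_mx // mxE. Qed.

End Entries.

Lemma smooth_entry a b U (M : 'rV[R]_n -> 'M[R]_(a, b)) i j : open U ->
  smooth U M -> smooth U (fun p => M p i j).
Proof.
move=> oU UM k; elim: k M UM => [|k IH] M UM.
  move=> p Up; apply: differentiable_continuous.
  exact/differentiable_entry/(smooth_differentiable UM).
split=> [p Up|l].
  exact/differentiable_entry/(smooth_differentiable UM).
apply: Ck_eq (IH _ (smooth_partial l UM)) => // p Up.
exact/derive_entry/(smooth_derivable UM).
Qed.

Lemma derive_coord (f : 'rV[R]_n -> R) p v : differentiable f p ->
  'D_v f p = \sum_i v 0 i * 'D_(delta_mx 0 i) f p.
Proof.
move=> df; rewrite deriveE // [X in 'd f p X]row_sum_delta raddf_sum.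
by apply: eq_bigr => i _; rewrite [LHS]linearZ deriveE.
Qed.

End CkTheory.

(** By the chain rule the partial derivatives of [f \o y] are sums of products
    of partial derivatives of [y] with functions of the same shape [f' \o y],
    to which the induction hypothesis applies. *)
Lemma smooth_comp (R : realType) m n (U : set 'rV[R]_n) (V : set 'rV[R]_m)
    (y : 'rV[R]_n -> 'rV[R]_m) (f : 'rV[R]_m -> R) :
  open U -> (forall p, U p -> V (y p)) -> smooth U y -> smooth V f ->
  smooth U (f \o y).
Proof.
move=> oU UV Uy + k; elim: k f => [|k IH] f Vf.
  move=> p Up; apply: differentiable_continuous; apply: differentiable_comp.
    exact: smooth_differentiable Uy Up.
  exact: smooth_differentiable Vf (UV p Up).
have dy p (Up : U p) := smooth_differentiable Uy Up.
have df p (Up : U p) := smooth_differentiable Vf (UV p Up).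
split=> [p Up|i]; first exact: differentiable_comp (dy p Up) (df p Up).
apply: (Ck_eq oU (f := fun p => \sum_j
  ('D_(delta_mx 0 i) y p) 0 j * ((fun q => 'D_(delta_mx 0 j) f q) \o y) p)).
  by move=> p Up; rewrite [RHS]derive_chain ?derive_coord; auto.
have Ck_sum (g : 'I_m -> 'rV[R]_n -> R) :
    (forall j, Ck k U (g j)) -> Ck k U (fun p => \sum_j g j p).
  move=> Ug; elim: (index_enum _) => [|j r IHr].
    by under eq_fun do rewrite big_nil; apply: Ck_cst.
  by under eq_fun do rewrite big_cons; apply: Ck_add.
apply: Ck_sum => j; apply: Ck_mul => //.
  by apply: smooth_entry => //; apply: smooth_partial.
by apply: IH; apply: smooth_partial.
Qed.

(** * Smooth matrices and the tensors of a metric *)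

Section SmoothMatrix.
Variables (R : realType) (n : nat) (U : set 'rV[R]_n).
Hypothesis oU : open U.

(** Smoothness is required entrywise rather than in the matrix norm: matrix
    operations are polynomial or rational in the entries, so that the closure
    properties of scalar functions apply. *)
Definition smooth_mx a b (M : 'rV[R]_n -> 'M[R]_(a, b)) :=
  forall i j, smooth U (fun p => M p i j).

Lemma smooth_mx_eq a b (M N : 'rV[R]_n -> 'M[R]_(a, b)) :
  (forall p, U p -> M p = N p) -> smooth_mx M -> smooth_mx N.
Proof.
by move=> MN UM i j; apply: smooth_eq (UM i j) => // p Up; rewrite MN.
Qed.

Lemma smooth_mx_cst a b (A : 'M[R]_(a, b)) : smooth_mx (fun=> A).
Proof. by move=> i j; apply: smooth_cst. Qed.

Lemma smooth_mx_add a b (M N : 'rV[R]_n -> 'M[R]_(a, b)) :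
  smooth_mx M -> smooth_mx N -> smooth_mx (fun p => M p + N p).
Proof.
by move=> UM UN i j; under eq_fun do rewrite mxE; apply: smooth_add.
Qed.

Lemma smooth_mx_scale a b (f : 'rV[R]_n -> R) (M : 'rV[R]_n -> 'M[R]_(a, b)) :
  smooth U f -> smooth_mx M -> smooth_mx (fun p => f p *: M p).
Proof.
by move=> Uf UM i j; under eq_fun do rewrite mxE; apply: smooth_mul.
Qed.

Lemma smooth_mx_opp a b (M : 'rV[R]_n -> 'M[R]_(a, b)) :
  smooth_mx M -> smooth_mx (fun p => - M p).
Proof. by move=> UM i j; under eq_fun do rewrite mxE; apply: smooth_opp. Qed.

Lemma smooth_mx_mul a b c (M : 'rV[R]_n -> 'M[R]_(a, b))
    (N : 'rV[R]_n -> 'M[R]_(b, c)) :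
  smooth_mx M -> smooth_mx N -> smooth_mx (fun p => M p *m N p).
Proof.
move=> UM UN i j; under eq_fun do rewrite mxE.
by apply: smooth_sum => // l _; apply: smooth_mul.
Qed.

Lemma smooth_mx_tr a b (M : 'rV[R]_n -> 'M[R]_(a, b)) :
  smooth_mx M -> smooth_mx (fun p => (M p)^T).
Proof. by move=> UM i j; under eq_fun do rewrite mxE; apply: UM. Qed.

Lemma smooth_mx_col a1 a2 b (M : 'rV[R]_n -> 'M[R]_(a1, b))
    (N : 'rV[R]_n -> 'M[R]_(a2, b)) :
  smooth_mx M -> smooth_mx N -> smooth_mx (fun p => col_mx (M p) (N p)).
Proof.
move=> UM UN i j; under eq_fun do rewrite mxE.
by case: (fintype.split i) => k; [exact: UM|exact: UN].
Qed.

Lemma smooth_mx_det a (M : 'rV[R]_n -> 'M[R]_a) :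
  smooth_mx M -> smooth U (fun p => \det (M p)).
Proof.
move=> UM; apply: smooth_sum => // s _.
by apply: smooth_mul => //; [apply: smooth_cst|apply: smooth_prod].
Qed.

(** Cramer's rule. *)
Lemma smooth_mx_inv a (M : 'rV[R]_n -> 'M[R]_a) :
  (forall p, U p -> M p \in unitmx) -> smooth_mx M ->
  smooth_mx (fun p => invmx (M p)).
Proof.
move=> M1 UM.
apply: (smooth_mx_eq (M := fun p => (\det (M p))^-1 *: \adj (M p))) => [p Up|].
  by rewrite /invmx M1.
apply: smooth_mx_scale => [|i j].
  apply: smooth_inv => // [p Up|]; last exact: smooth_mx_det.
  by rewrite -unitfE -unitmxE M1.
under eq_fun do rewrite mxE.
apply: smooth_mul => //; first exact: smooth_cst.
by apply: smooth_mx_det => k l; under eq_fun do rewrite !mxE; apply: UM.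
Qed.

Lemma smooth_inner (G : 'rV[R]_n -> 'M[R]_3) (X Y : 'rV[R]_n -> 'rV[R]_3) :
  smooth_mx G -> smooth_mx X -> smooth_mx Y ->
  smooth U (fun p => inner (G p) (X p) (Y p)).
Proof.
move=> UG UX UY; apply: (smooth_mx_mul _ (smooth_mx_tr UY)).
exact: smooth_mx_mul.
Qed.

Lemma smooth_cross (G : 'rV[R]_n -> 'M[R]_3) (X Y : 'rV[R]_n -> 'rV[R]_3) :
  (forall p, U p -> 0 < \det (G p)) ->
  smooth_mx G -> smooth_mx X -> smooth_mx Y ->
  smooth_mx (fun p => cross (G p) (X p) (Y p)).
Proof.
move=> G0 UG UX UY; apply: smooth_mx_mul; last first.
  apply: smooth_mx_inv => // p Up.
  by rewrite unitmxE unitfE gt_eqF // G0.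
move=> i j; under eq_fun do rewrite mxE.
apply: smooth_mul => //.
  (* The square root is smooth away from 0 only: drop the absolute value. *)
  apply: (smooth_eq oU (f := fun p => Num.sqrt (\det (G p)))) => [p Up|].
    by rewrite gtr0_norm // G0.
  by apply: smooth_sqrt => //; apply: smooth_mx_det.
apply: (@smooth_mx_det 3); apply: (@smooth_mx_col 1 2) => //.
by apply: (@smooth_mx_col 1 1) => //; apply: smooth_mx_cst.
Qed.

(** The derivative is linear in the direction, hence a combination of partial
    derivatives with the components of [e p] as coefficients. *)
Lemma smooth_mx_derive a b (e : 'rV[R]_n -> 'rV[R]_n)
    (M : 'rV[R]_n -> 'M[R]_(a, b)) :
  smooth_mx e -> smooth_mx M -> smooth_mx (fun p => 'D_(e p) M p).
Proof.
move=> Ue UM i j.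
apply: (smooth_eq oU (f := fun p =>
  \sum_k e p 0 k * 'D_(delta_mx 0 k) (fun q => M q i j) p)) => [p Up|].
  rewrite derive_entry; last first.
    by apply/derivable_mxP => k l; apply: (smooth_derivable (UM k l)).
  by rewrite -derive_coord //; apply: (smooth_differentiable (UM i j)).
apply: smooth_sum => // k _; apply: smooth_mul => //.
by apply: smooth_partial.
Qed.

Lemma smooth_derive (e : 'rV[R]_n -> 'rV[R]_n) (f : 'rV[R]_n -> R) :
  smooth_mx e -> smooth U f -> smooth U (fun p => 'D_(e p) f p).
Proof.
move=> Ue Uf; apply: (smooth_eq oU (f := fun p =>
  \sum_k e p 0 k * 'D_(delta_mx 0 k) f p)) => [p Up|].
  by rewrite -derive_coord //; apply: (smooth_differentiable Uf).
apply: smooth_sum => // k _; apply: smooth_mul => //.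
by apply: smooth_partial.
Qed.

End SmoothMatrix.

Section Tensors.
Variables (R : realType) (V : set 'rV[R]_3) (g : 'rV[R]_3 -> 'M[R]_3).
Hypotheses (oV : open V) (Vg : smooth_mx V g).
Hypothesis g_unit : forall q, V q -> g q \in unitmx.

Lemma smooth_christoffel k i j : smooth V (christoffel g k i j).
Proof.
apply: smooth_mul => //; first exact: smooth_cst.
apply: smooth_sum => // l _; apply: smooth_mul => //.
  exact: smooth_mx_inv.
apply: smooth_sub => //; last exact/smooth_partial/Vg.
by apply: smooth_add => //; apply/smooth_partial/Vg.
Qed.

Lemma smooth_riemann l k i j : smooth V (riemann g l k i j).
Proof.
apply: smooth_add => //.
  by apply: smooth_sub => //; apply/smooth_partial/smooth_christoffel.
apply: smooth_sum => // m _; apply: smooth_sub => //;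
  by apply: smooth_mul => //; apply: smooth_christoffel.
Qed.

Section Pulled.
Variables (n : nat) (U : set 'rV[R]_n) (y : 'rV[R]_n -> 'rV[R]_3).
Hypotheses (oU : open U) (Uy : smooth U y) (UV : forall p, U p -> V (y p)).

Lemma smooth_curvature (X Y Z : 'rV[R]_n -> 'rV[R]_3) :
  smooth_mx U X -> smooth_mx U Y -> smooth_mx U Z ->
  smooth_mx U (fun p => curvature g (y p) (X p) (Y p) (Z p)).
Proof.
move=> UX UY UZ z l; under eq_fun do rewrite mxE.
apply: smooth_sum => // i _; apply: smooth_sum => // j _.
apply: smooth_sum => // k _; do 3! apply: smooth_mul => //.
exact: (smooth_comp oU UV Uy (smooth_riemann l k i j)).
Qed.

End Pulled.

Variables (U : set 'rV[R]_2) (y : 'rV[R]_2 -> 'rV[R]_3).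
Hypotheses (oU : open U) (Uy : smooth U y) (UV : forall p, U p -> V (y p)).

Let Uy_mx : smooth_mx U y.
Proof. by move=> i j; apply: smooth_entry. Qed.

Lemma smooth_push e : smooth_mx U e -> smooth_mx U (push y e).
Proof. by move=> Ue; apply: smooth_mx_derive. Qed.

Lemma smooth_covariant N e : smooth_mx U N -> smooth_mx U e ->
  smooth_mx U (fun p => covariant g y N (e p) p).
Proof.
move=> UN Ue; apply: smooth_mx_add => //; first exact: smooth_mx_derive.
move=> z k; under eq_fun do rewrite mxE.
apply: smooth_sum => // i _; apply: smooth_sum => // j _.
apply: smooth_mul => //; apply: smooth_mul => //.
  exact: (smooth_comp oU UV Uy (smooth_christoffel k i j)).
exact: smooth_push.
Qed.

End Tensors.

(** * Symmetry of mixed derivatives *)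

Section Lines.
Variables (R : realType) (V W : normedModType R).
Implicit Types (f : V -> W) (q X : V).

Lemma is_derive_line f q X (s : R) d : is_derive (s *: X + q) X f d ->
  is_derive s 1 (fun t => f (t *: X + q)) d.
Proof.
have E : (fun h => h^-1 *: (((fun t => f (t *: X + q)) \o shift s) h%:A
             - f (s *: X + q))) =
         (fun h : R => h^-1 *: ((f \o shift (s *: X + q)) (h *: X)
             - f (s *: X + q))).
  by apply/funext => h /=; rewrite [h%:A]mulr1 scalerDl addrA.
by move=> [df <-]; split; rewrite /derivable /derive E.
Qed.

Lemma is_derive_of_line f q X d :
  is_derive (0 : R) 1 (fun t => f (t *: X + q)) d -> is_derive q X f d.
Proof.
have E : (fun h => h^-1 *: (((fun t => f (t *: X + q)) \o shift 0) h%:A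
             - f (0 *: X + q))) =
         (fun h : R => h^-1 *: ((f \o shift q) (h *: X) - f q)).
  by apply/funext => h /=; rewrite [h%:A]mulr1 addr0 scale0r add0r.
by move=> [df <-]; move: df; rewrite /derivable /derive E; split.
Qed.

Lemma derive_scale_dir f q X (k : R) : differentiable f q ->
  'D_(k *: X) f q = k *: 'D_X f q.
Proof. by move=> df; rewrite !deriveE // linearZ. Qed.

End Lines.

Section Young.
Variables (R : realType) (V : normedModType R).
Implicit Types (f gX gY : V -> R) (p X Y : V).

(** Apply the mean value theorem to
    [s |-> f (s X + t Y + p) - f (s X + p)] on [[0, t]]: the derivative is a
    difference of values of [gX], which is [t 'D_Y gX p] up to [o(t)] because
    [gX] is differentiable at [p]. *)
Lemma second_difference f gX p X Y (e : R) :
  (\forall q \near p, is_derive q X f (gX q)) -> differentiable gX p -> 0 < e ->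
  exists2 d, 0 < d & forall t, 0 < t < d ->
    `|f (t *: X + (t *: Y + p)) - f (t *: X + p) - f (t *: Y + p) + f p
      - t ^+ 2 * 'D_Y gX p| <= e * t ^+ 2.
Proof.
move=> fX dg e0; pose C := 2 * (`|X| + `|Y|) + 1.
(* [C t] bounds the sum of the norms of [s X + t Y] and [s X], [0 <= s <= t]. *)
have C0 : 0 < C by rewrite ltr_wpDl // mulr_ge0 // addr_ge0.
have eC : 0 < e / C by rewrite divr_gt0.
have : \forall h \near (0 : V), is_derive (h + p) X f (gX (h + p)) /\
    `|gX (h + p) - gX p - 'd gX p h| <= (e / C) * `|h|.
  have fX0 : \forall h \near (0 : V), is_derive (h + p) X f (gX (h + p)).
    by move: fX; rewrite (near_shift 0) subr0.
  by apply: filterS2 fX0 (differentiable_le dg eC) => h A B.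
move=> /nbhs_norm0P[d /= d0 Hd].
exists (d / C) => [|t /andP[t0 td]]; first by rewrite divr_gt0.
have small s : 0 <= s <= t -> `|s *: X + t *: Y| <= t * (`|X| + `|Y|) /\
     `|s *: X| <= t * (`|X| + `|Y|).
  move=> /andP[s0 st].
  have sX : `|s *: X| <= t * `|X| by rewrite normrZ ger0_norm // ler_wpM2r.
  have tY : `|t *: Y| = t * `|Y| by rewrite normrZ gtr0_norm.
  split; first by rewrite mulrDr (le_trans (ler_normD _ _)) // lerD ?tY.
  by rewrite mulrDr (le_trans sX) // lerDl mulr_ge0 // ltW.
have tC : t * (`|X| + `|Y|) < d.
  apply: le_lt_trans (_ : t * C < d); last by rewrite -ltr_pdivlMr.
  rewrite ler_pM2l // /C; have : 0 <= `|X| + `|Y| by rewrite addr_ge0.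
  lra.
pose phi s := f (s *: X + (t *: Y + p)) - f (s *: X + p).
pose dphi s := gX (s *: X + (t *: Y + p)) - gX (s *: X + p).
have der s : 0 <= s <= t -> is_derive s 1 phi (dphi s).
  move=> st; have [s1 s2] := small s st.
  apply: is_deriveB; apply: is_derive_line.
    by rewrite addrA; apply: (Hd _ _).1; rewrite /= (le_lt_trans s1).
  by apply: (Hd _ _).1; rewrite /= (le_lt_trans s2).
have [||c ct phit] := @MVT _ phi dphi 0 t t0.
- by move=> s; rewrite in_itv /= => /andP[s0 st]; apply: der; rewrite !ltW.
- apply: derivable_within_continuous => s; rewrite in_itv /= => st.
  by have [] := der s st.
have {}ct : 0 <= c <= t by move: ct; rewrite in_itv /= => /andP[? ?];
  rewrite !ltW.
have [c1 c2] := small c ct.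
have [_ A1] := Hd _ (le_lt_trans c1 tC); have [_ A2] := Hd _ (le_lt_trans c2 tC).
set a1 := (X in `|X|) in A1; set a2 := (X in `|X|) in A2.
rewrite (_ : _ - _ = t * (a1 - a2)); last first.
  have -> : f (t *: X + (t *: Y + p)) - f (t *: X + p) - f (t *: Y + p) + f p
     = phi t - phi 0 by rewrite /phi !scale0r !add0r; ring.
  rewrite phit /dphi /a1 /a2 (deriveE _ dg) !addrA linearD !linearZ /=.
  by rewrite /GRing.scale /=; ring.
rewrite normrM gtr0_norm // expr2 mulrCA ler_pM2l //.
apply: le_trans (ler_normB _ _) _; apply: le_trans (lerD A1 A2) _.
rewrite -mulrDr -mulrA ler_pM2l // -ler_pdivlMl ?invr_gt0 // invrK.
rewrite mulrC /C; have := lerD c1 c2.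
have : 0 <= t * 1 by rewrite mulr1 ltW.
lra.
Qed.

(** Young's theorem: the second difference is symmetric in [X] and [Y], so that
    dividing it by [t^2] gives both mixed derivatives in the limit.  Only the
    differentiability at [p] of the first derivatives is assumed, which is what
    a solution of a first order differential equation provides. *)
Lemma mixed_derivatives f gX gY p X Y :
  (\forall q \near p, is_derive q X f (gX q)) ->
  (\forall q \near p, is_derive q Y f (gY q)) ->
  differentiable gX p -> differentiable gY p -> 'D_Y gX p = 'D_X gY p.
Proof.
move=> fX fY dX dY; apply/eqP; rewrite -subr_eq0 -normr_le0.
apply/ler_addgt0Pl => e e0; rewrite addr0.
have e2 : 0 < e / 2 by rewrite divr_gt0.
have [d1 d10 H1] := second_difference Y fX dX e2.
have [d2 d20 H2] := second_difference X fY dY e2.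
pose t := Num.min d1 d2 / 2.
have m0 : 0 < Num.min d1 d2 by rewrite lt_min d10.
have t0 : 0 < t by rewrite divr_gt0.
have tm : t < Num.min d1 d2 by rewrite ltr_pdivrMr // ltr_pMr // ltr1n.
have /H1 {}H1 : 0 < t < d1 by rewrite t0 (lt_le_trans tm) // ge_min lexx.
have /H2 {}H2 : 0 < t < d2 by rewrite t0 (lt_le_trans tm) // ge_min lexx orbT.
have tt0 : 0 < t ^+ 2 by rewrite exprn_gt0.
rewrite -(ler_pM2l tt0) -[X in X * `|_|]gtr0_norm // -normrM.
set a := (X in `|X|) in H1; set b := (X in `|X|) in H2.
have -> : t ^+ 2 * ('D_Y gX p - 'D_X gY p) = b - a.
  rewrite /a /b [t *: Y + (t *: X + p)]addrCA; ring.
apply: le_trans (ler_normB _ _) _; apply: le_trans (lerD H2 H1) _.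
by rewrite -mulrDl -splitr mulrC.
Qed.

End Young.

(** * Potentials of closed forms *)

Lemma entry_le_norm (R : realType) a b (A : 'M[R]_(a, b)) i j :
  `|A i j| <= `|A|.
Proof.
rewrite [leRHS]/Num.Def.normr /= mx_normrE.
exact: (le_bigmax _ (fun k : 'I_a * 'I_b => `|A k.1 k.2|) (i, j)).
Qed.

Section Potential.
Variable R : realType.
Implicit Types (th : form1 R) (F : 'rV[R]_2 -> R) (p q X Y : 'rV[R]_2).

Lemma evE th q X : ev th q X = \sum_i X 0 i * th q i 0.
Proof. by rewrite /ev mxE. Qed.

Lemma ev_linear th q : linear (ev th q).
Proof. by move=> k X Y; rewrite /ev mulmxDl -scalemxAl !mxE. Qed.

Lemma evD th q X Y : ev th q (X + Y) = ev th q X + ev th q Y.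
Proof. by rewrite -[X]scale1r ev_linear !scale1r. Qed.

Lemma evZ th q k X : ev th q (k *: X) = k * ev th q X.
Proof. by rewrite /ev -scalemxAl mxE. Qed.

Lemma smooth_ev (U : set 'rV[R]_2) th X : open U -> smooth_mx U th ->
  smooth U (fun q => ev th q X).
Proof.
move=> oU Uth; apply: (smooth_mx_mul oU (smooth_mx_cst U X) Uth).
Qed.

(** The increment of [F] along a segment is, by the mean value theorem, a value
    of the form at an intermediate point, and the form is continuous. *)
Lemma differentiable_of_directional F th p :
  (\forall q \near p, forall X, is_derive q X F (ev th q X)) ->
  (forall i, {for p, continuous (fun q => th q i 0)}) -> differentiable F p.
Proof.
move=> dF cth.
pose l : {linear 'rV[R]_2 -> R} := HB.pack (ev th p)
  (GRing.isLinear.Build _ _ _ _ (ev th p) (ev_linear th p)).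
apply: (differentiable_eps (l := l)) => [|e e0].
  move=> q; rewrite /l /=.
  have -> : ev th p = fun X => \sum_i X 0 i * th p i 0.
    by apply/funext => X; rewrite evE.
  apply: differentiable_continuous.
  under eq_fun do rewrite !big_ord_recl big_ord0.
  apply: differentiableD; last apply: differentiableD => //;
    by apply: differentiableM => //; apply: differentiable_coord.
have e2 : 0 < e / 2 by rewrite divr_gt0.
have near_th i : \forall h \near (0 : 'rV[R]_2),
    `|th (h + p) i 0 - th p i 0| <= e / 2.
  have : \forall q \near p, `|th p i 0 - th q i 0| <= e / 2.
    by have /cvgrPdist_le/(_ _ e2) := cth i.
  rewrite (near_shift 0) subr0; apply: filterS => h /=.
  by rewrite distrC.
have dF0 : \forall h \near (0 : 'rV[R]_2), forall X,
    is_derive (h + p) X F (ev th (h + p) X).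
  by move: dF; rewrite (near_shift 0) subr0.
have : \forall h \near (0 : 'rV[R]_2),
    [/\ forall X, is_derive (h + p) X F (ev th (h + p) X),
        `|th (h + p) 0 0 - th p 0 0| <= e / 2 &
        `|th (h + p) (lift 0 0) 0 - th p (lift 0 0) 0| <= e / 2].
  by apply: filterS3 dF0 (near_th 0) (near_th (lift 0 0)) => h.
move=> /nbhs_norm0P[d /= d0 Hd]; apply/nbhs_norm0P; exists d => //= h hd.
pose phi s := F (s *: h + p); pose dphi s := ev th (s *: h + p) h.
have sh (s : R) : 0 <= s <= 1 -> `|s *: h| < d.
  move=> /andP[s0 s1]; apply: le_lt_trans hd.
  by rewrite normrZ ger0_norm // ler_piMl.
have der (s : R) : 0 <= s <= 1 -> is_derive s 1 phi (dphi s).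
  by move=> s01; apply: is_derive_line; have [] := Hd _ (sh _ s01).
have [||c ct] := @MVT _ phi dphi 0 1 ltr01.
- by move=> s; rewrite in_itv /= => /andP[s0 s1]; apply: der; rewrite !ltW.
- apply: derivable_within_continuous => s; rewrite in_itv /= => st.
  by have [] := der s st.
have {}ct : 0 <= c <= 1 by move: ct; rewrite in_itv /= => /andP[? ?];
  rewrite !ltW.
rewrite /phi /dphi scale1r scale0r add0r subr0 mulr1 => ->.
have [_ A0 A1] := Hd _ (sh _ ct).
rewrite /l /= !evE !big_ord_recl !big_ord0 !addr0.
set a := th _ _ _ in A0 *; set b := th _ _ _ in A0 *.
set a' := th _ _ _ in A1 *; set b' := th _ _ _ in A1 *.
rewrite (_ : _ - _ = h 0 0 * (a - b) + h 0 (lift 0 0) * (a' - b')); last by ring.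
apply: le_trans (ler_normD _ _) _; rewrite !normrM.
rewrite [e in leRHS]splitr mulrDl lerD // mulrC ler_pM //; exact: entry_le_norm.
Qed.

End Potential.

Section Poincare.
Variable R : realType.
Implicit Types (th : form1 R) (F : 'rV[R]_2 -> R) (p q X Y : 'rV[R]_2).

(** Provides the dominating constants for differentiation under the integral
    sign. *)
Lemma bounded_on_subball (f : 'rV[R]_2 -> R) p (r rho : R) : 0 <= rho < r ->
  smooth (ball p r) f ->
  exists M, forall q, `|q| <= rho -> `|f (q + p)| <= M.
Proof.
move=> /andP[rho0 rho_r] sf; pose K := closed_ball_ Num.norm p rho.
have Kp : K p by rewrite /K /closed_ball_ /= subrr normr0.
have KB : K `<=` ball p r.
  by move=> q Kq; rewrite -ball_normE /ball_ /=; apply: le_lt_trans rho_r.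
have cK : compact K.
  apply: bounded_closed_compact; last exact: closed_closed_ball_.
  exists (`|p| + rho); split; first exact: num_real.
  move=> M hM q Kq; apply: le_trans (ltW hM).
  rewrite -[q](subKr p); apply: le_trans (ler_normB _ _) _.
  by rewrite lerD2l.
have cf : {within K, continuous (fun q => `|f q|)}.
  apply: continuous_in_subspaceT => q /[1!inE] Kq.
  have cfq : f @ q --> f q.
    exact: differentiable_continuous (smooth_differentiable sf (KB _ Kq)).
  exact: cvg_norm cfq.
have [c _ Hc] := EVT_max_rV (ex_intro _ p Kp) cK cf.
exists `|f c| => q qrho; apply: Hc; rewrite inE /K /closed_ball_ /=.
by rewrite opprD addrCA subrr addr0 normrN.
Qed.

(** The potential at [v + p] is the integral of the form along the segment from
    [p] to [v + p].  Its derivative in the direction [X] is the integral of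
    [ev th (t v + p) X + t * 'D_X (ev th _ v) (t v + p)]; closedness replaces
    the last derivative by ['D_v (ev th _ X)], and the integrand becomes
    [d/dt (t * ev th (t v + p) X)], whose integral is [ev th (v + p) X]. *)
Lemma poincare p (r : R) th :
  smooth_mx (ball p r) th ->
  (forall q X Y, ball p r q -> extd th q X Y = 0) ->
  exists F, forall q X, ball p r q -> is_derive q X F (ev th q X).
Proof.
move=> sth closed_th; have oB : open (ball p r) by apply: ball_open.
have sev Y : smooth (ball p r) (fun q => ev th q Y) by apply: smooth_ev.
pose mu : {measure set (measurableTypeR R) -> \bar R} := lebesgue_measure.
exists (fun q => \int[mu]_(t in `[0, 1]) ev th (t *: (q - p) + p) (q - p)).
move=> q X Bq; have [v vE] : {v | v = q - p} by exists (q - p).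
have inB w : `|w| < r -> ball p r (w + p).
  by rewrite -ball_normE /ball_ /= opprD addrCA subrr addr0 normrN.
have vr : `|v| < r by rewrite vE; move: Bq; rewrite -ball_normE /ball_ /= distrC.
pose e := (r - `|v|) / (2 * (`|X| + 1)).
have X1 : 0 < `|X| + 1 by rewrite ltr_wpDl.
have e0 : 0 < e by rewrite divr_gt0 ?subr_gt0 // mulr_gt0.
pose rho := `|v| + e * `|X|.
have rho_r : 0 <= rho < r.
  apply/andP; split; first by rewrite addr_ge0 // mulr_ge0 // ltW.
  rewrite /rho addrC -ltrBrDr.
  have -> : r - `|v| = e * (2 * (`|X| + 1)) by rewrite /e divfK // gt_eqF // mulr_gt0.
  by rewrite ltr_pM2l //; have := normr_ge0 X; lra.
(* [z s t] runs over the segment from [p] to [s X + v + p = s X + q]; [e] keeps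
   all of them in the closed ball of radius [rho]. *)
pose z (s t : R) := s *: (t *: X) + (t *: v + p).
have zE s t : z s t = t *: (s *: X + v) + p.
  by rewrite /z scalerDr !scalerA [t * s]mulrC addrA.
have z_rho (s t : R) : - e < s < e -> 0 <= t <= 1 -> `|t *: (s *: X + v)| <= rho.
  move=> se /andP[t0 t1]; rewrite normrZ ger0_norm //.
  apply: le_trans (_ : `|s *: X + v| <= _); first by rewrite ler_piMl.
  apply: le_trans (ler_normD _ _) _; rewrite addrC lerD2l normrZ ler_wpM2r //.
  by rewrite ltW // ltr_norml.
have zB (s t : R) : - e < s < e -> 0 <= t <= 1 -> ball p r (z s t).
  move=> se t01; rewrite zE; apply: inB; apply: le_lt_trans (z_rho _ _ se t01) _.
  by case/andP: rho_r.
(* The integrand, and its derivative in [s]. *)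
pose f s t := s * ev th (z s t) X + ev th (z s t) v.
pose df s t := ev th (z s t) X + s * (t * 'D_X (fun q => ev th q X) (z s t))
                + t * 'D_X (fun q => ev th q v) (z s t).
have der_ev Y (s t : R) : - e < s < e -> 0 <= t <= 1 ->
    is_derive s 1 (fun s => ev th (z s t) Y)
      (t * 'D_X (fun q => ev th q Y) (z s t)).
  move=> se t01; apply: (is_derive_line (f := fun q => ev th q Y)).
  have dY := smooth_differentiable (sev Y) (zB _ _ se t01).
  split; first exact: diff_derivable.
  exact: derive_scale_dir.
have der_f (s t : R) : - e < s < e -> 0 <= t <= 1 ->
    is_derive s 1 (f ^~ t) (df s t).
  move=> se t01; have dX := der_ev X s t se t01; have dv := der_ev v s t se t01.
  apply: is_derive_eq; rewrite /df /GRing.scale /=; ring.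
have der_t (h : 'rV[R]_2 -> R) (s t : R) : smooth (ball p r) h ->
    - e < s < e -> 0 <= t <= 1 ->
    is_derive t 1 (fun t => h (z s t)) ('D_(s *: X + v) h (z s t)).
  move=> sh se t01; under eq_fun do rewrite zE; rewrite zE.
  apply: is_derive_line; apply: derivableP; apply: (smooth_derivable sh).
  by rewrite -zE; apply: zB.
have int01 (g : R -> R) : {within `[0, 1], continuous g} ->
    mu.-integrable `[0, 1] (EFin \o g).
  by apply: continuous_compact_integrable; apply: segment_compact.
have e00 : - e < (0 : R) < e by rewrite e0 oppr_lt0 e0.
have [M1 HM1] := bounded_on_subball rho_r (sev X).
have sD Y : smooth (ball p r) (fun q => 'D_X (fun q => ev th q Y) q).
  by apply: smooth_derive => //; apply: smooth_mx_cst.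
have [M2 HM2] := bounded_on_subball rho_r (sD X).
have [M3 HM3] := bounded_on_subball rho_r (sD v).
pose M := `|M1| + e * `|M2| + `|M3|.
have M0 : 0 <= M by rewrite !addr_ge0 // mulr_ge0 // ltW.
have df_le s t : - e < s < e -> 0 <= t <= 1 -> `|df s t| <= M.
  move=> se t01; have zr := z_rho _ _ se t01.
  have se' : `|s| <= e by rewrite ltW // ltr_norml.
  have t1 : `|t| <= 1 by case/andP: t01 => ? ?; rewrite ger0_norm.
  have := HM1 _ zr; have := HM2 _ zr; have := HM3 _ zr; rewrite -zE => h3 h2 h1.
  apply: le_trans (ler_normD _ _) _; apply: lerD.
    apply: le_trans (ler_normD _ _) _; apply: lerD.
      exact: le_trans h1 (ler_norm _).
    rewrite normrM ler_pM // normrM -[leRHS]mul1r ler_pM //.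
    exact: le_trans h2 (ler_norm _).
  rewrite normrM -[leRHS]mul1r ler_pM //.
  exact: le_trans h3 (ler_norm _).
have fE s t : f s t = ev th (t *: (s *: X + v) + p) (s *: X + v).
  by rewrite /f zE evD evZ.
have I0 : `]- e, e[%classic (0 : R) by rewrite /= in_itv.
have intf s : `]- e, e[%classic s -> mu.-integrable `[0, 1] (EFin \o f s).
  rewrite /= in_itv /= => se; apply: int01.
  apply: derivable_within_continuous => t; rewrite in_itv /= => t01.
  have dX := der_t _ s t (sev X) se t01; have dv := der_t _ s t (sev v) se t01.
  exact: ex_derive.
have derf1 s t : `]- e, e[%classic s -> `[0, 1]%classic t ->
    derivable (f ^~ t) s 1.
  by rewrite /= !in_itv /= => se t01; have [] := der_f s t se t01.
have intM : mu.-integrable `[0, 1] (EFin \o (cst M)).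
  by apply: int01; apply: continuous_subspaceT; apply: cst_continuous.
have G_ub s t : `]- e, e[%classic s -> `[0, 1]%classic t ->
    `|partial1of2 f s t| <= cst M t.
  rewrite /= !in_itv /= => se t01; have [_] := der_f s t se t01.
  by rewrite partial1of2E => ->; apply: df_le.
have m01 : measurable (`[0, 1]%classic : set (measurableTypeR R)).
  exact: measurable_itv.
have D1 := derivable_under_integral m01 I0 intf derf1 (fun=> M0) intM G_ub.
have D2 := differentiation_under_integral m01 I0 intf derf1 (fun=> M0) intM G_ub.
pose g t := t * ev th (z 0 t) X.
have der_g (t : R) : 0 <= t <= 1 -> is_derive t 1 g (df 0 t).
  move=> t01; have dX := der_t _ 0 t (sev X) e00 t01.
  apply: is_derive_eq; rewrite /df scale0r add0r mul0r addr0 /GRing.scale /=.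
  have := closed_th _ X v (zB _ _ e00 t01); rewrite /extd => /subr0_eq ->.
  ring.
have int_df : \int[mu]_(t in `[0, 1]) df 0 t = ev th q X.
  have cdf : {within `[0, 1], continuous (df 0)}.
    apply: derivable_within_continuous => t; rewrite in_itv /= => t01.
    have h1 := der_t _ 0 t (sev X) e00 t01; have h2 := der_t _ 0 t (sD X) e00 t01.
    have h3 := der_t _ 0 t (sD v) e00 t01.
    exact: ex_derive.
  have dg : derivable_oo_LRcontinuous g 0 1.
    have cg (t : R) : 0 <= t <= 1 -> {for t, continuous g}.
      move=> /der_g[dgt _].
      by apply: differentiable_continuous; apply/derivable1_diffP.
    split.
    - by move=> t; rewrite in_itv /= => /andP[? ?]; have [] := der_g t; rewrite ?ltW.
    - by apply: cvg_at_right_filter; apply: cg; rewrite lexx ler01.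
    - by apply: cvg_at_left_filter; apply: cg; rewrite lexx ler01.
  rewrite /Rintegral (continuous_FTC2 ltr01 cdf dg) /=.
    rewrite /g mul1r mul0r subr0 /z scale0r add0r scale1r vE subrK //.
  move=> t; rewrite in_itv /= => /andP[? ?].
  by rewrite derive1E; have [] := der_g t; rewrite ?ltW.
apply: is_derive_of_line.
have -> : (fun s : R => \int[mu]_(t in `[0, 1])
    ev th (t *: (s *: X + q - p) + p) (s *: X + q - p)) =
    (fun s => \int[mu]_(t in `[0, 1]) f s t).
  apply/funext => s; apply: eq_Rintegral => t _.
  by rewrite fE vE addrA.
split; first exact: D1.
rewrite -derive1E D2 -int_df; apply: eq_Rintegral => t.
rewrite inE /= in_itv /= => t01; have [_] := der_f 0 t e00 t01.
by rewrite partial1of2E.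
Qed.
End Poincare.

(** * Smoothness of the forms attached to the surface *)

Lemma det_minkowski (R : realType) : \det (minkowski R) = 1.
Proof.
rewrite det_diag !big_ord_recl big_ord0 !mxE /=.
by rewrite mul1r mulr1 mulrNN mulr1.
Qed.

(** The determinant of the Gram matrix has the sign of that of the signature,
    which has an even number of minus signs. *)
Lemma lorentzian_det_gt0 (R : realType) (L : oriented_manifold R 3)
    (g : lorentzian_metric L) i q :
  dom L i q -> 0 < \det (g i (chart L i q)).
Proof.
move=> /(metric_signature g)[P Pu /(congr1 determinant)].
rewrite !det_mulmx det_tr det_minkowski => E.
move: Pu; rewrite unitmxE unitfE => P0.
have P2 : 0 < \det P ^+ 2 by rewrite exprn_even_gt0.
by rewrite -(pmulr_rgt0 _ P2) expr2 mulrAC E.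
Qed.

Section DualCoframe.
Variables (R : realType) (U : set 'rV[R]_2) (e1 e2 : 'rV[R]_2 -> 'rV[R]_2).
Variables (om1 om2 : form1 R).
Hypotheses (oU : open U) (Ue1 : smooth_mx U e1) (Ue2 : smooth_mx U e2).
Hypothesis om_dual : dual_coframe U e1 e2 om1 om2.

(** The coframe is the inverse of the matrix of the frame. *)
Lemma smooth_dual_coframe : smooth_mx U om1 /\ smooth_mx U om2.
Proof.
pose E p : 'M[R]_2 := col_mx (e1 p) (e2 p).
pose O p : 'M[R]_2 := row_mx (om1 p) (om2 p).
have EO p : U p -> E p *m O p = 1%:M.
  move=> /om_dual[h11 h12 h21 h22].
  apply: (etrans (mul_col_row (e1 p) (e2 p) (om1 p) (om2 p))).
  apply: (etrans _ (esym (@scalar_mx_block R 1 1 1))).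
  move: h11 h12 h21 h22; rewrite /ev => h11 h12 h21 h22.
  congr block_mx; apply/matrixP => i j; rewrite !ord1 ?h11 ?h12 ?h21 ?h22 mxE //.
have UE : smooth_mx U E by apply: (@smooth_mx_col _ _ _ 1 1).
have UO : smooth_mx U O.
  apply: (smooth_mx_eq oU (M := fun p => invmx (E p))) => [p Up|].
    have [Eu _] := mulmx1_unit (EO p Up).
    by rewrite -[LHS]mulmx1 -(EO p Up) mulKmx.
  apply: smooth_mx_inv => // p Up.
  by have [] := mulmx1_unit (EO p Up).
split=> i j; rewrite ord1.
  have E1 p : U p -> O p i (lshift 1 (0 : 'I_1)) = om1 p i 0.
    by rewrite /O (row_mxEl (om1 p)).
  exact: smooth_eq oU E1 (UO i _).
have E2 p : U p -> O p i (rshift 1 (0 : 'I_1)) = om2 p i 0.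
  by rewrite /O (row_mxEr (om1 p)).
exact: smooth_eq oU E2 (UO i _).
Qed.

End DualCoframe.

Section SurfaceForms.
Variables (R : realType) (L : oriented_manifold R 3) (g : lorentzian_metric L).
Variables (D : set 'rV[R]_2) (x : 'rV[R]_2 -> L).
Variables (e1 e2 : 'rV[R]_2 -> 'rV[R]_2) (om1 om2 : form1 R).
Variables (a c u v la1 la2 : 'rV[R]_2 -> R).
Hypotheses (D_open : open D) (x_embedding : embedding D x).
Hypotheses (e1_smooth : smooth D e1) (e2_smooth : smooth D e2).
Hypothesis e_orthonormal : orthonormal_frame g D x e1 e2.
Hypothesis e_principal : principal_frame g D x e1 e2 a c.
Hypothesis J_gt0 : forall p, D p -> 0 < (a p - c p) / 2.
Hypothesis om_dual : dual_coframe D e1 e2 om1 om2.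
Hypothesis uv_def : mean_curvature_differential D om1 om2 a c u v.
Hypothesis la_def : normal_curvature g D x e1 e2 om1 om2 a c la1 la2.

Let ac_neq0 p : D p -> a p - c p != 0.
Proof. by move=> /J_gt0; rewrite pmulr_lgt0 ?invr_gt0 // => /gt_eqF ->. Qed.

Section InChart.
Variable i : index L.
Let U := D `&` x @^-1` dom L i.
Let V := chart L i @` dom L i.
Let y := local_expr x i.

Lemma open_chart_domain : open U.
Proof.
have [cx _ _ _ _] := x_embedding.
rewrite openE => p [Dp xp]; apply: filterI.
  exact: open_nbhs_nbhs.
exact: (cx p Dp) (open_nbhs_nbhs (conj (dom_open i) xp)).
Qed.
Let oU := open_chart_domain.

Let oV : open V.
Proof. by apply: chart_open => //; apply: dom_open. Qed.

Let Vg : smooth_mx V (g i).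
Proof. by move=> k l; apply: smooth_entry => //; apply: metric_smooth. Qed.

Let g_det q : V q -> 0 < \det (g i q).
Proof. by move=> [z iz <-]; apply: lorentzian_det_gt0. Qed.

Let g_unit q : V q -> g i q \in unitmx.
Proof. by move=> /g_det; rewrite unitmxE unitfE => /gt_eqF ->. Qed.

Let Uy : smooth U y.
Proof. by have [_ + _ _ _] := x_embedding; apply. Qed.

Let UV p : U p -> V (y p).
Proof. by move=> [_ xp]; exists (x p). Qed.

Let UD : U `<=` D. Proof. by move=> p []. Qed.

Let Ue1 : smooth_mx U e1.
Proof.
by move=> k l; apply: smooth_entry => //; apply: smooth_subset e1_smooth.
Qed.

Let Ue2 : smooth_mx U e2.
Proof.
by move=> k l; apply: smooth_entry => //; apply: smooth_subset e2_smooth.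
Qed.

Let UG : smooth_mx U (fun p => g i (y p)).
Proof. by move=> k l; apply: (smooth_comp oU UV Uy (Vg k l)). Qed.

Let Upush e : smooth_mx U e -> smooth_mx U (push y e).
Proof. by move=> Ue; apply: smooth_push. Qed.

Let Unormal : smooth_mx U (unit_normal (g i) y e1 e2).
Proof.
apply: smooth_cross => //; [|exact: Upush..].
by move=> p /UV/g_det.
Qed.

Let Ushape e : smooth_mx U e ->
  smooth_mx U (fun p => shape (g i) y e1 e2 (e p) p).
Proof.
move=> Ue; apply: smooth_mx_opp => //.
exact: (smooth_covariant oV Vg g_unit oU Uy UV Unormal Ue).
Qed.

(** Pairing [A e_1 = a e_1] with [e_1], and [A e_2 = c e_2] with [e_2], recovers
    the principal curvatures from the shape operator. *)
Lemma smooth_principal_curvatures : smooth U a /\ smooth U c.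
Proof.
split.
  apply: (smooth_eq oU (f := fun p => inner (g i (y p))
    (shape (g i) y e1 e2 (e1 p) p) (push y e1 p))) => [p [Dp xp]|].
    have [-> _] := e_principal Dp xp.
    have [e11 _ _] := e_orthonormal Dp xp.
    by rewrite /inner -!scalemxAl mxE [X in _ * X]e11 mulr1.
  by apply: smooth_inner => //; [apply: Ushape|apply: Upush].
apply: (smooth_eq oU (f := fun p => - inner (g i (y p))
    (shape (g i) y e1 e2 (e2 p) p) (push y e2 p))) => [p [Dp xp]|].
  have [_ ->] := e_principal Dp xp.
  have [_ _ e22] := e_orthonormal Dp xp.
  by rewrite /inner -!scalemxAl mxE [X in _ * X]e22 mulrN1 opprK.
apply: smooth_opp => //.
by apply: smooth_inner => //; [apply: Ushape|apply: Upush].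
Qed.

Let Uac : smooth U (fun p => a p - c p).
Proof. by have [? ?] := smooth_principal_curvatures; apply: smooth_sub. Qed.

(** Evaluating [2 dH] on the frame isolates [(a - c) u] and [(a - c) v], and
    [a - c] does not vanish. *)
Lemma smooth_uv : smooth U u /\ smooth U v.
Proof.
have [Ua Uc] := smooth_principal_curvatures.
have UH : smooth U (mean_curvature a c).
  apply: smooth_mul => //; last exact: smooth_cst.
  exact: smooth_add.
have quot e (w : 'rV[R]_2 -> R) : smooth_mx U e ->
    (forall p, U p -> ev (lincomb u v om1 om2) p (e p) = w p) -> smooth U w.
  move=> Ue we; apply: (smooth_eq oU (f := fun p =>
    2 * 'D_(e p) (mean_curvature a c) p / (a p - c p))) => [p Up|].
    rewrite uv_def ?we; [|by []|exact: UD].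
    by rewrite mulrAC divff ?mul1r // ac_neq0 //; apply: UD.
  apply: smooth_div => // [p /UD/ac_neq0 //|].
  by apply: smooth_mul => //; [exact: smooth_cst|exact: smooth_derive].
have ev_lin p X : ev (lincomb u v om1 om2) p X =
    u p * ev om1 p X + v p * ev om2 p X.
  by rewrite /ev /lincomb mulmxDr -!scalemxAr !mxE.
split.
  apply: (quot e1) => // p /UD/om_dual[h11 h12 h21 h22].
  by rewrite ev_lin h11 h21; ring.
apply: (quot e2) => // p /UD/om_dual[h11 h12 h21 h22].
by rewrite ev_lin h12 h22; ring.
Qed.

(** Evaluating the curvature 2-forms on the frame isolates [(c - a) la1] and
    [(c - a) la2]. *)
Lemma smooth_lambda : smooth U la1 /\ smooth U la2.
Proof.
have Upsi e X Y : smooth_mx U e -> smooth_mx U X -> smooth_mx U Y ->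
    smooth U (fun p => psi3 g x e1 e2 i e p (X p) (Y p)).
  move=> Ue UX UY; apply: smooth_inner => //.
  apply: (smooth_curvature oV Vg g_unit oU Uy UV); exact: Upush.
have Uca : smooth U (fun p => c p - a p).
  by apply: smooth_eq (smooth_opp oU Uac) => // p _; rewrite opprB.
have ca_neq0 p : U p -> c p - a p != 0.
  by move=> /UD/ac_neq0; rewrite -oppr_eq0 opprB.
split.
  apply: (smooth_eq oU (f := fun p =>
    psi3 g x e1 e2 i e1 p (e2 p) (e1 p) / (c p - a p))) => [p Up|].
    have [-> _] := la_def (e2 p) (e1 p) Up.1 Up.2.
    have [h11 h12 h21 h22] := om_dual (UD Up).
    rewrite /wedge h11 h12 h21 h22; field; exact: ca_neq0.
  by apply: smooth_div => //; apply: Upsi.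
apply: (smooth_eq oU (f := fun p =>
    psi3 g x e1 e2 i e2 p (e1 p) (e2 p) / (c p - a p))) => [p Up|].
  have [_ ->] := la_def (e1 p) (e2 p) Up.1 Up.2.
  have [h11 h12 h21 h22] := om_dual (UD Up).
  rewrite /wedge h11 h12 h21 h22; field; exact: ca_neq0.
by apply: smooth_div => //; apply: Upsi.
Qed.

Lemma smooth_gamma_in_chart :
  smooth_mx U (gamma1 om1 om2 u v la1 la2) /\
  smooth_mx U (gamma2 om1 om2 u v la1 la2).
Proof.
have [Uom1 Uom2] : smooth_mx U om1 /\ smooth_mx U om2.
  by apply: (smooth_dual_coframe oU Ue1 Ue2) => p /UD; apply: om_dual.
have [Uu Uv] := smooth_uv; have [Ul1 Ul2] := smooth_lambda.
have Ulin s t : smooth U s -> smooth U t -> smooth_mx U (lincomb s t om1 om2).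
  by move=> Us Ut; apply: smooth_mx_add => //; apply: smooth_mx_scale.
split; apply: smooth_mx_add => //.
- by apply: Ulin => //; apply: smooth_opp.
- apply: smooth_mx_opp => //; apply: smooth_mx_scale => //; last exact: Ulin.
  exact: smooth_cst.
- by apply: Ulin => //; apply: smooth_opp.
- apply: smooth_mx_opp => //; apply: smooth_mx_scale => //; last exact: Ulin.
  exact: smooth_cst.
Qed.

End InChart.

Lemma smooth_gamma :
  smooth_mx D (gamma1 om1 om2 u v la1 la2) /\
  smooth_mx D (gamma2 om1 om2 u v la1 la2).
Proof.
have chart_at p : D p -> exists i, (D `&` x @^-1` dom L i) p.
  by move=> Dp; have [i ip] := dom_cover (x p); exists i.
split=> k l n; apply: Ck_local => p /chart_at[i Up];
  exists (D `&` x @^-1` dom L i) => //; have [H1 H2] := smooth_gamma_in_chart i.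
  exact: H1.
exact: H2.
Qed.

End SurfaceForms.

(** * The total differential equation *)

Section TotalDifferentialEquation.
Variables (R : realType) (D : set 'rV[R]_2) (gm1 gm2 : form1 R).
Hypotheses (D_open : open D).
Hypotheses (sgm1 : smooth_mx D gm1) (sgm2 : smooth_mx D gm2).

Lemma solution_is_derive (U : set 'rV[R]_2) T p X : solution U gm1 gm2 T ->
  U p -> is_derive p X T (T p * ev gm1 p X + ev gm2 p X).
Proof.
move=> solT Up; have [dT DT] := solT p Up.
by split; [exact: diff_derivable|exact: DT].
Qed.

(** This is [d (dT) = 0]: the right-hand side of [dT = T gm1 + gm2] is
    differentiable, so that Young's theorem applies to [T], and the two mixed
    derivatives are computed by differentiating the equation once. *)
Lemma solution_compatibility (U : set 'rV[R]_2) T p X Y :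
  open U -> U `<=` D -> solution U gm1 gm2 T -> U p ->
  T p * extd gm1 p X Y + (extd gm2 p X Y - wedge gm1 gm2 p X Y) = 0.
Proof.
move=> oU UD solT Up; have Dp := UD p Up.
have [dT DT] := solT p Up.
pose G X q := T q * ev gm1 q X + ev gm2 q X.
have nearG Z : \forall q \near p, is_derive q Z T (G Z q).
  apply: (filterS _ (open_nbhs_nbhs (conj oU Up))) => q Uq.
  exact: solution_is_derive Uq.
have d1 Z : differentiable (fun q => ev gm1 q Z) p.
  exact: smooth_differentiable (smooth_ev Z D_open sgm1) Dp.
have d2 Z : differentiable (fun q => ev gm2 q Z) p.
  exact: smooth_differentiable (smooth_ev Z D_open sgm2) Dp.
have dG Z : differentiable (G Z) p.
  by apply: differentiableD => //; apply: differentiableM.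
have DG Z W : 'D_W (G Z) p = T p * 'D_W (fun q => ev gm1 q Z) p
    + ev gm1 p Z * (T p * ev gm1 p W + ev gm2 p W)
    + 'D_W (fun q => ev gm2 q Z) p.
  have dTW : is_derive p W T (T p * ev gm1 p W + ev gm2 p W).
    exact: solution_is_derive Up.
  have := derivableP (diff_derivable (v := W) (d1 Z)).
  have := derivableP (diff_derivable (v := W) (d2 Z)).
  move=> i2 i1; apply: (@derive_val _ _ _ _ _ (G Z)).
  by apply: is_derive_eq; rewrite /GRing.scale /=; ring.
have := mixed_derivatives (nearG X) (nearG Y) (dG X) (dG Y).
rewrite !DG /extd /wedge => /eqP; rewrite -subr_eq0 => /eqP E.
by rewrite -[RHS]oppr0 -E; ring.
Qed.

(** The equation is affine, hence is solved by variation of constants in place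
    of Frobenius' theorem.  On a ball [gm1 = df]; then
    [d (exp (- f) gm2) = exp (- f) (d gm2 - gm1 /\ gm2) = 0], so that
    [exp (- f) gm2 = dh], and [exp f * (h + C)] is a solution, where [C] fits
    the prescribed value. *)
Lemma completely_integrable_of_compatibility :
  (forall p X Y, D p -> extd gm1 p X Y = 0) ->
  (forall p X Y, D p -> extd gm2 p X Y = wedge gm1 gm2 p X Y) ->
  completely_integrable D gm1 gm2.
Proof.
move=> closed1 closed2 p T0 Dp.
have /nbhs_ballP[r /= r0 BD] := open_nbhs_nbhs (conj D_open Dp).
set B := ball p r in BD.
have oB : open B by apply: ball_open.
have s1 : smooth_mx B gm1 by move=> i j; apply: smooth_subset (sgm1 i j).
have s2 : smooth_mx B gm2 by move=> i j; apply: smooth_subset (sgm2 i j).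
have potential_diff th F : smooth_mx B th ->
    (forall q X, B q -> is_derive q X F (ev th q X)) ->
    forall q, B q -> differentiable F q.
  move=> sth dF q Bq; apply: (differentiable_of_directional (th := th)).
    apply: (filterS _ (open_nbhs_nbhs (conj oB Bq))) => q' Bq' X.
    exact: dF.
  move=> i; apply: differentiable_continuous.
  exact: smooth_differentiable (sth i 0) Bq.
have [f df] : exists f, forall q X, B q -> is_derive q X f (ev gm1 q X).
  by apply: poincare => // q X Y /BD; apply: closed1.
have diff_f := potential_diff _ _ s1 df.
have sf : smooth B f.
  apply: smooth_of_partials => // i.
  apply: (smooth_eq oB _ (smooth_ev (delta_mx 0 i) oB s1)) => q Bq.
  by have [_] := df q (delta_mx 0 i) Bq.
have sef : smooth B (fun q => expR (- f q)).
  by apply: smooth_expR => //; apply: smooth_opp.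
pose th : form1 R := fun q => expR (- f q) *: gm2 q.
have evth q X : ev th q X = expR (- f q) * ev gm2 q X.
  by rewrite /ev /th -scalemxAr mxE.
have sth : smooth_mx B th by apply: smooth_mx_scale.
have Dth q X Y : B q -> 'D_X (fun q => ev th q Y) q =
    expR (- f q) * ('D_X (fun q => ev gm2 q Y) q - ev gm1 q X * ev gm2 q Y).
  move=> Bq; have dfX := df q X Bq.
  have i2 := derivableP (smooth_derivable (p := q) (X := X) (smooth_ev Y oB s2) Bq).
  have [_ De] : differentiable (expR \o (fun q => - f q)) q /\
     'D_X (expR \o (fun q => - f q)) q = 'D_X (fun q => - f q) q * expR (- f q).
    apply: derive_comp_real; apply: differentiableN; exact: diff_f.
  have ie := derivableP (smooth_derivable (p := q) (X := X) sef Bq).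
  have -> : (fun q => ev th q Y) = (fun q => expR (- f q) * ev gm2 q Y).
    by apply/funext => q'; rewrite evth.
  have efq : 'D_X (fun q => expR (- f q)) q = - ev gm1 q X * expR (- f q).
    by rewrite [LHS]De [X in X * _]derive_val.
  apply: (@derive_val _ _ _ _ _ (fun q => expR (- f q) * ev gm2 q Y)).
  by apply: is_derive_eq; rewrite efq /GRing.scale /=; ring.
have [h dh] : exists h, forall q X, B q -> is_derive q X h (ev th q X).
  apply: poincare => // q X Y Bq; rewrite /extd !Dth //.
  have := closed2 q X Y (BD _ Bq); rewrite /extd /wedge => /eqP.
  rewrite -subr_eq0 => /eqP E.
  by rewrite -[RHS](mulr0 (expR (- f q))) -E; ring.
have diff_h := potential_diff _ _ sth dh.
pose C := T0 / expR (f p) - h p.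
exists B, (fun q => expR (f q) * (h q + C)); split => //.
- exact: ballxx.
- move=> q Bq; have [d1 D1] : differentiable (expR \o f) q /\
    forall X, 'D_X (expR \o f) q = ev gm1 q X * expR (f q).
    have dc X := derive_comp_real X (is_derive_expR (f q)) (diff_f q Bq).
    split; first by have [] := dc 0.
    by move=> X; have [_ ->] := dc X; have [_ ->] := df q X Bq.
  have d2 : differentiable (fun q => h q + C) q.
    by apply: differentiableD; [exact: diff_h|exact: differentiable_cst].
  split=> [|X]; first exact: differentiableM.
  have dhX := dh q X Bq.
  have iE := derivableP (diff_derivable (v := X) d1).
  have eC : expR (f q) * expR (- f q) = 1.
    by rewrite expRN mulfV // gt_eqF // expR_gt0.
  apply: (@derive_val _ _ _ _ _ (fun q => expR (f q) * (h q + C))).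
  apply: is_derive_eq; rewrite evth [X in _ + _ *: X]D1 /GRing.scale /= addr0.
  rewrite mulrA eC; ring.
- by rewrite /C addrC subrK mulrC divfK // gt_eqF // expR_gt0.
Qed.

End TotalDifferentialEquation.

Theorem theorem3p4 (R : realType)
  (L : oriented_manifold R 3) (g : lorentzian_metric L)
  (D : set 'rV[R]_2) (x : 'rV[R]_2 -> L)
  (e1 e2 : 'rV[R]_2 -> 'rV[R]_2) (om1 om2 : form1 R)
  (a c u v la1 la2 : 'rV[R]_2 -> R)
  (D_open : open D) (x_embedding : embedding D x)
  (e1_smooth : smooth D e1) (e2_smooth : smooth D e2)
  (e_orthonormal : orthonormal_frame g D x e1 e2)
  (e_principal : principal_frame g D x e1 e2 a c)
  (J_gt0 : forall p, D p -> 0 < (a p - c p) / 2)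
  (om_dual : dual_coframe D e1 e2 om1 om2)
  (uv_def : mean_curvature_differential D om1 om2 a c u v)
  (la_def : normal_curvature g D x e1 e2 om1 om2 a c la1 la2)
  (H_or_K : ~ (exists h, forall p, D p -> mean_curvature a c p = h) \/
            ~ (forall p, D p -> la1 p = 0 /\ la2 p = 0)) :
  let gm1 := gamma1 om1 om2 u v la1 la2 in
  let gm2 := gamma2 om1 om2 u v la1 la2 in
  (forall (U : set 'rV[R]_2) (T : 'rV[R]_2 -> R),
     open U -> U `<=` D -> solution U gm1 gm2 T ->
     forall p X Y, U p ->
       T p * extd gm1 p X Y + (extd gm2 p X Y - wedge gm1 gm2 p X Y) = 0) /\
  (completely_integrable D gm1 gm2 <->
   (forall p X Y, D p -> extd gm1 p X Y = 0) /\
   (forall p X Y, D p -> extd gm2 p X Y = wedge gm1 gm2 p X Y)).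
Proof.
move=> gm1 gm2.
have [sgm1 sgm2] : smooth_mx D gm1 /\ smooth_mx D gm2.
  exact: (smooth_gamma D_open x_embedding e1_smooth e2_smooth e_orthonormal
    e_principal J_gt0 om_dual uv_def la_def).
split=> [U T oU UD solT p X Y Up|].
  exact: (solution_compatibility D_open sgm1 sgm2 X Y oU UD solT Up).
split=> [ci|[closed1 closed2]]; last exact: completely_integrable_of_compatibility.
(* Integrability prescribes the value of [T] at [p]: the compatibility identity
   is affine in it and holds at the values 0 and 1. *)
have compat p T0 X Y : D p ->
    T0 * extd gm1 p X Y + (extd gm2 p X Y - wedge gm1 gm2 p X Y) = 0.
  move=> /(ci p T0)[U [T [oU Up UD solT <-]]].
  exact: (solution_compatibility D_open sgm1 sgm2 X Y oU UD solT Up).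
have eq2 p X Y : D p -> extd gm2 p X Y = wedge gm1 gm2 p X Y.
  by move=> Dp; apply/subr0_eq; rewrite -(compat p 0 X Y Dp) mul0r add0r.
split=> // p X Y Dp; rewrite -(compat p 1 X Y Dp) eq2 // subrr addr0 mul1r //.
Qed.
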